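(* Let $n\ge2$. For each $\ell$ in the set $$L=\{0,1\}^n\setminus\{(0,0,\ldots,0),(1,1,\ldots,1)\},$$ choose a vector $\mathbf{x}_\ell\in\mathbb{Z}^n$ having $N(\mathbf{x}_\ell)=1$ and having non-zero entries exactly where $\ell$ does. Let $G_n=\{\mathbf{x}_\ell\}_{\ell\in L}$ and let $$H_n=G_n\cup\{\mathbf{e}_i\}_i\cup\{\mathbf{e}_i\pm\mathbf{e}_j: i\ne j\}\cup\{2\mathbf{e}_i\}_i,\qquad H_n'=H_n\cup\{2\mathbf{e}_i+\mathbf{e}_j: i\neq j\}.$$ Then $\mathbb{Z}^n$ is $H_n$-integrally implied by $H_n'$.
   Context: $\mathbf{e}_i$ are the standard basis vectors of $\mathbb{Z}^n$ and $N(\mathbf v)=\max_i|v_i|$ is the sup-norm. For $I=\mathbb{Z}^n$, let $\mathcal{M}$ be the ideal of the polynomial ring $\mathbb{Z}[T_i]_{i\in I}$ generated by $T_0$ and all polynomials $$T_{p+q+s}T_{p-q}T_{r+s}T_r+T_{q+r+s}T_{q-r}T_{p+s}T_p+T_{r+p+s}T_{r-p}T_{q+s}T_q\qquad(p,q,r,s\in I),$$ and let $\mathcal{W}_I$ be the quotient of $\mathbb{Z}[T_i]_{i\in I}/\mathcal{M}$ by its nilradical. For subsets $S,J\subset I$ with $0\notin S$, an index $i\in I$ is $S$-integrally implied by $J$ if there exist a monomial $P$ (with coefficient $\pm1$) in the variables $T_s$, $s\in S$, and a polynomial $Q$ with integer coefficients in the variables $T_j$, $j\in J$, such that $$T_i\,P(T_s)=Q(T_j)\quad\text{in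 }\mathcal{W}_I.$$ A set $K\subset I$ is $S$-integrally implied by $J$ if every index in $K$ is. *)

(* Defs.v *)
From HB Require Import structures.
From mathcomp Require Import all_boot all_order all_algebra.
From mathcomp Require Import finmap boolp classical_sets.
From mathcomp Require Import monalg.

Set Implicit Arguments.
Unset Strict Implicit.
Unset Printing Implicit Defensive.

Import GRing.Theory.

Local Open Scope ring_scope.
Local Open Scope classical_set_scope.
Local Open Scope quotient_scope.

Section Ideals.
Variable R : comNzRingType.

Definition ideal_gen (G : set R) : set R :=
  [set x | exists2 s : seq (R * R),
     (forall c, c \in s -> G c.2) & x = \sum_(c <- s) c.1 * c.2].

Lemma ideal_gen_linear (G : set R) a u v :
  ideal_gen G u -> ideal_gen G v -> ideal_gen G (a * u + v).
Proof.
move=> [s Gs ->] [t Gt ->]; exists ([seq (a * c.1, c.2) | c <- s] ++ t).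
  by move=> c; rewrite mem_cat => /orP[/mapP[d /Gs Gd ->]|/Gt].
rewrite big_cat big_map /= mulr_sumr; congr (_ + _).
by apply: eq_bigr => c _; rewrite mulrA.
Qed.

Definition nilrad : R -> bool := fun x => `[< exists k : nat, x ^+ k = 0 >].

Lemma nilrad_idealr : idealr_closed nilrad.
Proof.
split; first by apply/asboolP; exists 1%N; rewrite expr1.
  by apply/asboolP=> -[k]; rewrite expr1n; apply/eqP/oner_neq0.
move=> a u v /asboolP[k uk] /asboolP[l vl]; apply/asboolP.
exists (k + l)%N; rewrite exprDn big1 // => i _.
have [li|/ltnW il] := leqP l i.
  by rewrite -(subnK li) [v ^+ _]exprD vl !mulr0 mul0rn.
have ki : (k <= k + l - i)%N by rewrite -addnBA // leq_addr.
by rewrite exprMn -(subnK ki) [u ^+ _]exprD uk !(mulr0, mul0r) mul0rn.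
Qed.

HB.instance Definition _ := isIdealr.Build R nilrad nilrad_idealr.

End Ideals.

Fact pi_idealE (R : comNzRingType) (J : idealr R) (a b : R) :
  \pi_{ideal_quot J} a = \pi_{ideal_quot J} b <-> a - b \in J.
Proof. by rewrite Quotient.idealrBE; split=> /eqP. Qed.

Fact rmorph_lin3 (R S : comNzRingType) (f : {rmorphism R -> S}) a b c x y z :
  f x = 0 -> f y = 0 -> f z = 0 -> f (a * x + b * y + c * z) = 0.
Proof. by move=> x0 y0 z0; rewrite !rmorphD !rmorphM x0 y0 z0 !mulr0 !addr0. Qed.

Section NetRing.
Variable I : zmodType.

(* Z[T_i]_{i in I}: the monoid algebra of the finitely supported exponent
   functions I -> nat. *)
Definition netpoly : Type := {malg int[{cmonom I}]}.
HB.instance Definition _ := GRing.ComNzRing.on netpoly.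

Definition T (i : I) : netpoly := << ucm i >>.

Definition net_rel (p q r s : I) : netpoly :=
    T (p + q + s) * T (p - q) * T (r + s) * T r
  + T (q + r + s) * T (q - r) * T (p + s) * T p
  + T (r + p + s) * T (r - p) * T (q + s) * T q.

Definition net_gens : set netpoly :=
  [set f | f = T 0 \/ exists p q r s, f = net_rel p q r s].

Definition net_ideal : netpoly -> bool := fun f => `[< ideal_gen net_gens f >].

Lemma net_ideal_idealr : idealr_closed net_ideal.
Proof.
have [c0 c0T] : exists c0 : {rmorphism netpoly -> int}, forall i, c0 (T i) = 0.
  by exists (@mcoeff {cmonom I} int mone) => i; rewrite /= mcoeffU1 cm1_eq1.
split; first by apply/asboolP; exists [::]; rewrite ?big_nil.
  apply/asboolP=> -[s Gs] /(congr1 c0).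
  have -> : c0 (\sum_(c <- s) c.1 * c.2) = 0.
    rewrite rmorph_sum big_seq big1 // => c /Gs Gc; rewrite rmorphM.
    suff -> : c0 c.2 = 0 by rewrite mulr0.
    case: Gc => [->|[p [q [r [t ->]]]]]; first exact: c0T.
    exact: rmorph_lin3 (c0T _) (c0T _) (c0T _).
  by rewrite rmorph1 => /eqP; rewrite oner_eq0.
move=> a u v /asboolP Gu /asboolP Gv; apply/asboolP.
exact: ideal_gen_linear.
Qed.

HB.instance Definition _ := isIdealr.Build netpoly net_ideal net_ideal_idealr.

Definition netquot : Type := {ideal_quot (net_ideal : idealr netpoly)}.
HB.instance Definition _ := GRing.ComNzRing.on netquot.

Definition W : Type := {ideal_quot (@nilrad netquot : idealr netquot)}.
HB.instance Definition _ := GRing.ComNzRing.on W.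

Definition to_W (f : netpoly) : W :=
  \pi_{ideal_quot (@nilrad netquot : idealr netquot)}
    (\pi_{ideal_quot (net_ideal : idealr netpoly)} f : netquot).

Lemma to_W_eqP (f g : netpoly) :
  to_W f = to_W g <-> exists k : nat, ideal_gen net_gens ((f - g) ^+ k).
Proof.
have piX h k : (\pi_{ideal_quot (net_ideal : idealr netpoly)} h) ^+ k = 0
    <-> ideal_gen net_gens (h ^+ k).
  rewrite -rmorphXn -(rmorph0 (\pi_{ideal_quot (net_ideal : idealr netpoly)})).
  by rewrite pi_idealE subr0; split=> /asboolP.
rewrite /to_W pi_idealE -rmorphB.
by split=> [/asboolP[k /piX]|[k /piX fgk]]; [exists k|apply/asboolP; exists k].
Qed.

Definition monom_in (A : set I) (m : {cmonom I}) : Prop :=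
  forall i, i \in finsupp m -> A i.

Definition poly_in (A : set I) (f : netpoly) : Prop :=
  forall m, m \in msupp f -> monom_in A m.

(* The monomial P of the text is (-1) ^+ b * << m >>.  The proviso 0 \notin S is
   kept inside the predicate: T 0 vanishes in W, so without it every index would
   be implied as soon as S contained 0. *)
Definition index_implied (S J : set I) (i : I) : Prop :=
  ~ S 0 /\
  exists (b : bool) (m : {cmonom I}) (Q : netpoly),
    [/\ monom_in S m, poly_in J Q &
        to_W (T i * ((-1) ^+ b * << m >>)) = to_W Q].

Definition integrally_implied (S J K : set I) : Prop :=
  forall i, K i -> index_implied S J i.

End NetRing.

Section Vectors.
Variable n : nat.

Definition supnorm (v : 'rV[int]_n) : nat := \max_(i < n) `|v 0%R i|%N.

Definition e (i : 'I_n) : 'rV[int]_n := delta_mx 0 i.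

Definition L : set {ffun 'I_n -> bool} :=
  [set l | l <> [ffun=> false] /\ l <> [ffun=> true]].

Variable x : {ffun 'I_n -> bool} -> 'rV[int]_n.

Definition Gset : set 'rV[int]_n := x @` L.

Definition Hset : set 'rV[int]_n :=
  Gset
  `|` [set v | exists i, v = e i]
  `|` [set v | exists i j, i != j /\ (v = e i + e j \/ v = e i - e j)]
  `|` [set v | exists i, v = e i *+ 2].

Definition Hset' : set 'rV[int]_n :=
  Hset `|` [set v | exists i j, i != j /\ v = e i *+ 2 + e j].

End Vectors.

(* Main.v *)
From HB Require Import structures.
Require Import Defs.
From mathcomp Require Import all_boot all_order all_algebra.
From mathcomp Require Import finmap classical_sets.
From mathcomp Require Import monalg.
From mathcomp Require Import ring zify.

(** Write t v for the class of the variable T v in W.  Two facts about t are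
    used.  First, t is odd: the relation with p = q gives
    t v ^ 3 (t v + t (- v)) = 0 and W has no nilpotents ([net_odd]).
    Second, the net relation becomes symmetric after a change of variables: if
    2 y = v + u1 + u2 + u3, then t v t u1 t u2 t u3 is a difference of two
    monomials in the values of t at the eight vectors
    (v +- u1 +- u2 +- u3) / 2 ([net_halving]).

    The elements w of W such that w times a monomial in the t s, s in H_n, is a
    polynomial in the t j, j in H_n', form a subring that is stable under
    division by each such t s ([clearable]).  Hence v is implied as soon as
    u1, u2, u3 can be found in H_n, up to sign, with v + u1 + u2 + u3 even and
    with the eight vectors above implied ([implied_halving]).  Everything else
    is a question about vectors: each v outside H_n' needs three vectors of
    H_n for which the eight vectors are smaller than v.

    When N(v) >= 3 almost any choice with the correct parity makes N drop, since
    the new vectors have size about N(v) / 2 ([implied_descent]).  This is where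
    G_n enters: it provides, for every parity pattern other than the constant
    ones, a vector with entries 0, 1, -1.  The exception is N(v) = 3 with all
    entries 3 or -3; there one step leaves at most one entry of size 3
    ([implied_norm_le3]).

    When N(v) <= 2 the vectors are compared entrywise: no entry grows in
    absolute value, and one entry drops.  The device that forces a drop is
    u1 = +- e_j +- e_k with signs opposite to those of v at exactly one of the
    two indices: whichever sign u1 takes, it cancels against v at j or at k.
    (Vectors with exactly three non-zero entries, all 1 or -1, are treated in
    one step that ends directly at the vectors below.)
    The descent ends at combinations a e_i + b e_j with |a| <= 2 and |b| <= 1.
    Such a vector is 0, or belongs to H_n' up to sign, or is 2 e_i - e_j up to
    sign, which follows from H_n' in one step. *)

Set Implicit Arguments.
Unset Strict Implicit.
Unset Printing Implicit Defensive.

Import GRing.Theory.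

Local Open Scope ring_scope.
Local Open Scope classical_set_scope.

(** * Elliptic nets with values in a reduced ring *)

Definition elliptic_net (I : zmodType) (R : comNzRingType) (t : I -> R) : Prop :=
  t 0 = 0 /\ forall p q r s : I,
    t (p + q + s) * t (p - q) * t (r + s) * t r
  + t (q + r + s) * t (q - r) * t (p + s) * t p
  + t (r + p + s) * t (r - p) * t (q + s) * t q = 0.

Definition reduced (R : comNzRingType) : Prop :=
  forall (w : R) k, w ^+ k = 0 -> w = 0.

(** With a = t v and b = t (- v), the relation at (v, v, 0, 0) reads
    a ^ 3 (a + b) = 0, and likewise b ^ 3 (a + b) = 0.  Each monomial of
    (a + b) ^ 5 is divisible by a ^ 3 or b ^ 3, so (a + b) ^ 6 = 0. *)
Lemma net_odd (I : zmodType) (R : comNzRingType) (t : I -> R) v :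
  elliptic_net t -> reduced R -> t (- v) = - t v.
Proof.
move=> [t0 t_rel] R_reduced.
have cube u : t u ^+ 3 * (t u + t (- u)) = 0.
  have := t_rel u u 0 0.
  by rewrite !subrr t0 !(addr0, add0r, subr0, sub0r) => <-; ring.
have a3 := cube v; have := cube (- v); rewrite opprK => b3.
apply/eqP; rewrite -addr_eq0; apply/eqP; apply: (R_reduced _ 6).
move: (t v) (t (- v)) a3 b3 => a b a3 b3.
have -> : (b + a) ^+ 6 =
   (a ^+ 2 + 5%:R * a * b + 10%:R * b ^+ 2) * (a ^+ 3 * (a + b))
 + (10%:R * a ^+ 2 + 5%:R * a * b + b ^+ 2) * (b ^+ 3 * (b + a)) by ring.
by rewrite a3 b3 !mulr0 addr0.
Qed.

(** This is the net relation at p = y - u2, q = y - u1 - u2, r = u3 and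
    s = u2 - u3, chosen so that p + q + s = 2 y - u1 - u2 - u3, p - q = u1,
    r + s = u2 and r = u3. *)
Lemma net_halving n (R : comNzRingType) (t : 'rV[int]_n -> R) y u1 u2 u3 :
  elliptic_net t -> reduced R ->
  t (y + y - u1 - u2 - u3) * t u1 * t u2 * t u3 =
    t y * t (y - u1 - u2) * t (y - u1 - u3) * t (y - u2 - u3)
  - t (y - u1) * t (y - u2) * t (y - u3) * t (y - u1 - u2 - u3).
Proof.
move=> net_t R_reduced.
have E (a b : 'rV[int]_n) : (forall i, a 0 i = b 0 i) -> t a = t b.
  by move=> ab; congr t; apply/rowP.
have := net_t.2 (y - u2) (y - u1 - u2) u3 (u2 - u3).
rewrite (E _ (y + y - u1 - u2 - u3)) => [|i]; last by rewrite !mxE; ring.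
rewrite (E (_ - (y - u1 - u2)) u1) => [|i]; last by rewrite !mxE; ring.
rewrite (E (u3 + (u2 - u3)) u2) => [|i]; last by rewrite !mxE; ring.
rewrite (E (_ + u3 + _) (y - u1)) => [|i]; last by rewrite !mxE; ring.
rewrite (E (y - u2 + (u2 - u3)) (y - u3)) => [|i]; last by rewrite !mxE; ring.
rewrite (E (u3 + _ + _) y) => [|i]; last by rewrite !mxE; ring.
rewrite (E (u3 - _) (- (y - u2 - u3))) => [|i]; last by rewrite !mxE; ring.
rewrite (E (y - u1 - u2 + (u2 - u3)) (y - u1 - u3)) => [|i]; last first.
  by rewrite !mxE; ring.
rewrite net_odd // => h; apply/eqP; rewrite -subr_eq0 -h; apply/eqP; ring.
Qed.

(** * The universal net *)

(** The shape of a net relation: three products of four factors each. *)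
Lemma rmorph_quartic (A B : comNzRingType) (f : {rmorphism A -> B})
    (a1 a2 a3 a4 b1 b2 b3 b4 c1 c2 c3 c4 : A) :
  f (a1 * a2 * a3 * a4 + b1 * b2 * b3 * b4 + c1 * c2 * c3 * c4) =
    f a1 * f a2 * f a3 * f a4 + f b1 * f b2 * f b3 * f b4
    + f c1 * f c2 * f c3 * f c4.
Proof. by rewrite !(rmorphD, rmorphM). Qed.

Lemma rmorph_mul_sign0 (A B : comNzRingType) (f : {rmorphism A -> B}) a b :
  f (a * ((-1) ^+ false * b)) = f a * f b.
Proof. by rewrite mul1r rmorphM. Qed.

Section UniversalNet.
Variable I : zmodType.
Implicit Types f g : netpoly I.

Lemma to_W_surj (w : W I) : exists f, w = to_W f.
Proof. by exists (repr (repr w : netquot I)); rewrite /to_W !reprK. Qed.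

Lemma to_WB f g : to_W (f - g) = to_W f - to_W g.
Proof. by rewrite /to_W rmorphB rmorphB. Qed.

Lemma to_WM f g : to_W (f * g) = to_W f * to_W g.
Proof. by rewrite /to_W rmorphM rmorphM. Qed.

Lemma to_W1 : to_W (1 : netpoly I) = 1.
Proof. by rewrite /to_W rmorph1 rmorph1. Qed.

Lemma to_W0 : to_W (0 : netpoly I) = 0.
Proof. by rewrite -(subrr (0 : netpoly I)) to_WB subrr. Qed.

Lemma to_WX f k : to_W (f ^+ k) = to_W f ^+ k.
Proof.
by elim: k => [|k IHk]; [rewrite !expr0 to_W1 | rewrite !exprS to_WM IHk].
Qed.

(** An existence statement, so that the morphism is afterwards known only
    through its algebraic laws and not through the two nested quotients. *)
Lemma to_W_rmorphism :
  exists phi : {rmorphism netpoly I -> W I}, forall f, to_W f = phi f.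
Proof.
have to_W_zmod : zmod_morphism (@to_W I) := to_WB.
have to_W_monoid : monoid_morphism (@to_W I).
  by split; [exact: to_W1 | exact: to_WM].
by exists (HB.pack_for {rmorphism netpoly I -> W I} (@to_W I)
  (GRing.isZmodMorphism.Build _ _ _ to_W_zmod)
  (GRing.isMonoidMorphism.Build _ _ _ to_W_monoid)).
Qed.

Lemma W_reduced : reduced (W I).
Proof.
move=> w k; have [f ->] := to_W_surj w.
rewrite -to_WX -to_W0 => /to_W_eqP[l]; rewrite subr0 => fkl.
by apply/to_W_eqP; exists (k * l)%N; rewrite exprM subr0.
Qed.

Lemma to_W_net_gens f : net_gens f -> to_W f = to_W 0.
Proof.
move=> Gf; apply/to_W_eqP; exists 1%N.
rewrite expr1 subr0; exists [:: (1, f)]; last by rewrite big_seq1 mul1r.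
by move=> c; rewrite inE => /eqP->.
Qed.

Lemma universal_net (phi : {rmorphism netpoly I -> W I}) :
  (forall f, to_W f = phi f) -> elliptic_net (fun v => phi (T v)).
Proof.
move=> to_WE.
have gen0 f : net_gens f -> phi f = 0.
  by move=> /to_W_net_gens; rewrite !to_WE rmorph0.
split; first by apply: gen0; left.
move=> p q r s; rewrite -[LHS]rmorph_quartic; apply: gen0.
by right; exists p, q, r, s.
Qed.

End UniversalNet.

(** * Clearing denominators *)

Lemma malgU_mmul (K : monomType) (k1 k2 : K) :
  << mmul k1 k2 >> = << k1 >> * << k2 >> :> {malg int[K]}.
Proof. by rewrite malgM_def fgmulUU mulr1. Qed.

Section Clearable.
Variables (I : zmodType) (S J : set I).
Implicit Types (A : set I) (f g : netpoly I) (m : {cmonom I}).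

Lemma monom_in1 A : monom_in A mone.
Proof. by move=> i; rewrite mem_finsupp cm1. Qed.

Lemma monom_inM A m1 m2 :
  monom_in A m1 -> monom_in A m2 -> monom_in A (mmul m1 m2).
Proof.
move=> A1 A2 i; rewrite mem_finsupp cmM addn_eq0 negb_and => /orP[mi|mi].
  by apply: A1; rewrite mem_finsupp.
by apply: A2; rewrite mem_finsupp.
Qed.

Lemma monom_inU A i : A i -> monom_in A (ucm i).
Proof. by move=> Ai j; rewrite mem_finsupp cmU; have [<-|] := eqVneq i j. Qed.

Lemma poly_in_monom A m : monom_in A m -> poly_in A << m >>.
Proof. by move=> Am m' /(fsubsetP msuppU_le); rewrite in_fset1 => /eqP->. Qed.

Lemma poly_inD A f g : poly_in A f -> poly_in A g -> poly_in A (f + g).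
Proof.
by move=> Af Ag m /(fsubsetP (msuppD_le f g)); rewrite inE => /orP[/Af|/Ag].
Qed.

Lemma poly_inN A f : poly_in A f -> poly_in A (- f).
Proof. by move=> Af m; rewrite msuppN => /Af. Qed.

Lemma poly_inM A f g : poly_in A f -> poly_in A g -> poly_in A (f * g).
Proof.
by move=> Af Ag m /msuppM_le[m1 [m2 [/Af A1 /Ag A2 ->]]]; apply: monom_inM.
Qed.

Lemma monom1 : << mone >> = 1 :> netpoly I.
Proof. exact: (@mpolyC1E {cmonom I} int). Qed.

Lemma monomM m1 m2 : << mmul m1 m2 >> = << m1 >> * << m2 >> :> netpoly I.
Proof. exact: malgU_mmul. Qed.

Variables (R : comNzRingType) (phi : {rmorphism netpoly I -> R}).
Hypothesis SJ : S `<=` J.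

Definition monom_value (d : R) : Prop :=
  exists2 m, monom_in S m & d = phi << m >>.

Definition poly_value (a : R) : Prop := exists2 Q, poly_in J Q & a = phi Q.

Lemma monom_value1 : monom_value 1.
Proof. by exists mone; [exact: monom_in1 | rewrite monom1 rmorph1]. Qed.

Lemma monom_valueM d1 d2 :
  monom_value d1 -> monom_value d2 -> monom_value (d1 * d2).
Proof.
move=> [m1 S1 ->] [m2 S2 ->]; exists (mmul m1 m2); first exact: monom_inM.
by rewrite monomM rmorphM.
Qed.

Lemma monom_value_poly d : monom_value d -> poly_value d.
Proof.
move=> [m Sm ->]; exists << m >> => //.
by apply: poly_in_monom => i /Sm/SJ.
Qed.

Lemma poly_valueD a b : poly_value a -> poly_value b -> poly_value (a + b).
Proof.
move=> [P JP ->] [Q JQ ->]; exists (P + Q); first exact: poly_inD.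
by rewrite (rmorphD phi P).
Qed.

Lemma poly_valueM a b : poly_value a -> poly_value b -> poly_value (a * b).
Proof.
move=> [P JP ->] [Q JQ ->]; exists (P * Q); first exact: poly_inM.
by rewrite (rmorphM phi P).
Qed.

Lemma poly_valueN a : poly_value a -> poly_value (- a).
Proof.
move=> [P JP ->]; exists (- P); first exact: poly_inN.
by rewrite (rmorphN phi P).
Qed.

(** The condition that defines an implied index, extended from the images of
    the variables T i to arbitrary elements of R.  The elements that satisfy it
    form a subring, so it can be propagated through polynomial identities. *)
Definition clearable (w : R) : Prop :=
  exists2 d, monom_value d & poly_value (w * d).

Lemma clearable_T i : J i -> clearable (phi (T i)).
Proof.
move=> Ji; exists 1; [exact: monom_value1 | rewrite mulr1].
by exists (T i) => //; apply: poly_in_monom; apply: monom_inU.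
Qed.

Lemma clearable0 : clearable 0.
Proof.
exists 1; [exact: monom_value1 | rewrite mul0r -(subrr 1)].
have one : poly_value 1 by apply/monom_value_poly/monom_value1.
exact/poly_valueD/poly_valueN.
Qed.

Lemma clearableD w z : clearable w -> clearable z -> clearable (w + z).
Proof.
move=> [d Sd Jwd] [c Sc Jzc]; exists (d * c); first exact: monom_valueM.
have -> : (w + z) * (d * c) = w * d * c + z * c * d by ring.
by apply: poly_valueD; apply: poly_valueM => //; apply: monom_value_poly.
Qed.

Lemma clearableN w : clearable w -> clearable (- w).
Proof. by move=> [d Sd Jwd]; exists d; rewrite ?mulNr //; apply: poly_valueN. Qed.

Lemma clearableM w z : clearable w -> clearable z -> clearable (w * z).
Proof.
move=> [d Sd Jwd] [c Sc Jzc]; exists (d * c); first exact: monom_valueM.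
by rewrite mulrACA; apply: poly_valueM.
Qed.

(** The element T i joins the denominator. *)
Lemma clearable_div i w : S i -> clearable (w * phi (T i)) -> clearable w.
Proof.
move=> Si [d Sd]; rewrite -mulrA => Jwd; exists (phi (T i) * d) => //.
by apply: monom_valueM => //; exists (ucm i) => //; apply: monom_inU.
Qed.

End Clearable.

(** C stands for the clearable elements and t for the universal net; only the
    closure properties below matter to the argument. *)
Section HalvingStep.
Variables (n : nat) (R : comNzRingType) (t : 'rV[int]_n -> R).
Variables (S : set 'rV[int]_n) (C : R -> Prop).
Hypothesis R_reduced : reduced R.
Hypothesis net_t : elliptic_net t.
Hypothesis CD : forall w z, C w -> C z -> C (w + z).
Hypothesis CN : forall w, C w -> C (- w).
Hypothesis CM : forall w z, C w -> C z -> C (w * z).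
Hypothesis CS : forall s, S s -> C (t s).
Hypothesis C_div : forall s w, S s -> C (w * t s) -> C w.
Implicit Types u v : 'rV[int]_n.

Definition up_to_sign v : Prop := S v \/ S (- v).

Lemma implied_opp v : C (t v) -> C (t (- v)).
Proof. by rewrite net_odd //; apply: CN. Qed.

Lemma up_to_signN v : up_to_sign v -> up_to_sign (- v).
Proof. by case=> Sv; [right; rewrite opprK | left]. Qed.

Lemma up_to_sign_implied v : up_to_sign v -> C (t v).
Proof.
case=> Sv; first exact: CS.
by rewrite -(opprK v); apply/implied_opp/CS.
Qed.

Let C_div_sign u w : up_to_sign u -> C (w * t u) -> C w.
Proof.
case=> Su; first exact: C_div.
rewrite -(opprK u) net_odd // mulrN => /CN; rewrite opprK.
exact: C_div.
Qed.

(** The relation 2 w = v +- u1 +- u2 +- u3, stated entrywise with signs in int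
    so that integer arithmetic applies to it directly. *)
Definition half_combination (v u1 u2 u3 w : 'rV[int]_n) : Prop :=
  exists s1 s2 s3 : int,
    [/\ s1 = 1 \/ s1 = -1, s2 = 1 \/ s2 = -1, s3 = 1 \/ s3 = -1 &
        forall l, w 0 l + w 0 l =
          v 0 l + s1 * u1 0 l + s2 * u2 0 l + s3 * u3 0 l].

(** Halving expresses t v t u1 t u2 t u3 through t at the eight vectors w; the
    three factors t u1, t u2, t u3 can then be divided out. *)
Lemma implied_halving v u1 u2 u3 :
  up_to_sign u1 -> up_to_sign u2 -> up_to_sign u3 ->
  (forall l, (2 %| (v 0 l + u1 0 l + u2 0 l + u3 0 l)%R)%Z) ->
  (forall w, half_combination v u1 u2 u3 w -> C (t w)) ->
  C (t v).
Proof.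
move=> S1 S2 S3 even_sum imp_half.
have [y yE] : exists y : 'rV[int]_n, forall l,
    y 0 l + y 0 l = v 0 l + u1 0 l + u2 0 l + u3 0 l.
  exists (\row_l ((v 0 l + u1 0 l + u2 0 l + u3 0 l)%R %/ 2)%Z) => l.
  by rewrite !mxE; have := even_sum l; lia.
have vE : v = y + y - u1 - u2 - u3 by apply/rowP => l; rewrite !mxE yE; ring.
have imp_y (c1 c2 c3 : bool) :
    C (t (y - u1 *+ c1 - u2 *+ c2 - u3 *+ c3)).
  apply: imp_half; exists ((-1) ^+ c1), ((-1) ^+ c2), ((-1) ^+ c3).
  split=> [|||l]; [by case: c1; [right|left] | by case: c2; [right|left]
                  | by case: c3; [right|left] |].
  (* Subtracting u1 from y reverses the sign of u1 in 2 y. *)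
  have := yE l; rewrite !mxE !mulmxnE.
  by case: c1; case: c2; case: c3; rewrite /= ?mulr1n ?mulr0n; lia.
rewrite vE; apply: (C_div_sign S1); apply: (C_div_sign S2).
apply: (C_div_sign S3); rewrite (net_halving y u1 u2 u3 net_t R_reduced).
apply: CD; last apply: CN; do 3?[apply: CM].
- by have := imp_y false false false; rewrite /= !subr0.
- by have := imp_y true true false; rewrite /= subr0.
- by have := imp_y true false true; rewrite /= subr0.
- by have := imp_y false true true; rewrite /= subr0.
- by have := imp_y true false false; rewrite /= !subr0.
- by have := imp_y false true false; rewrite /= !subr0.
- by have := imp_y false false true; rewrite /= !subr0.
exact: (imp_y true true true).
Qed.

End HalvingStep.

(** * Descent on vectors *)

Section Coordinates.
Variable n : nat.
Implicit Types (v : 'rV[int]_n) (i j l : 'I_n).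

Lemma eE i l : e i 0 l = (l == i)%:Z.
Proof. by rewrite /e mxE eqxx /=; case: (l == i). Qed.

Lemma eDE i j l : (e i + e j) 0 l = (l == i)%:Z + (l == j)%:Z.
Proof. by rewrite mxE !eE. Qed.

Lemma e2E i l : (e i *+ 2) 0 l = (l == i)%:Z + (l == i)%:Z.
Proof. by rewrite mulr2n eDE. Qed.

Lemma two_coordinates v i j : i != j ->
  (forall l, l != i -> l != j -> v 0 l = 0) ->
  v = v 0 i *: e i + v 0 j *: e j.
Proof.
move=> ij v0; apply/rowP => l; rewrite !mxE eqxx /=.
have [->|li] := eqVneq l i; first by rewrite (negbTE ij) /= mulr1 mulr0 addr0.
have [->|lj] := eqVneq l j; last by rewrite v0 // !mulr0.
by rewrite mulr0 add0r mulr1.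
Qed.

End Coordinates.

(** The hypotheses list all that the descent uses: which vectors are inverted
    (those of H_n, up to sign), which are implied at the start, and the halving
    step. *)
Section Descent.
Variable n : nat.
Implicit Types (v w u : 'rV[int]_n) (i j k l : 'I_n).

Variables (inverted implied : 'rV[int]_n -> Prop).

Hypothesis n_ge2 : (2 <= n)%N.
Hypothesis invertedN : forall v, inverted v -> inverted (- v).
Hypothesis inverted_e : forall i, inverted (e i).
Hypothesis inverted_2e : forall i, inverted (e i *+ 2).
Hypothesis inverted_eD : forall i j, i != j -> inverted (e i + e j).
Hypothesis inverted_eB : forall i j, i != j -> inverted (e i - e j).
Hypothesis inverted_support : forall P : pred 'I_n,
  (exists i, P i) -> (exists i, ~~ P i) ->
  exists2 u, inverted u & forall l, `|u 0%R l|%N = P l.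
Hypothesis inverted_implied : forall v, inverted v -> implied v.
Hypothesis implied0 : implied 0.
Hypothesis impliedN : forall v, implied v -> implied (- v).
Hypothesis implied_2eDe : forall i j, i != j -> implied (e i *+ 2 + e j).
Hypothesis implied_halving : forall v u1 u2 u3,
  inverted u1 -> inverted u2 -> inverted u3 ->
  (forall l, (2 %| (v 0 l + u1 0 l + u2 0 l + u3 0 l)%R)%Z) ->
  (forall w, half_combination v u1 u2 u3 w -> implied w) ->
  implied v.

Lemma exists_other i : exists j, j != i.
Proof.
have lt_n : ((i == 0%N :> nat) < n)%N by lia.
by exists (Ordinal lt_n); rewrite -val_eqE /=; lia.
Qed.

Lemma inverted_pair i j (a b : int) : i != j -> `|a|%N = 1%N -> `|b|%N = 1%N ->
  exists u, [/\ inverted u, u 0 i = a, u 0 j = b &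
    forall l, l != i -> l != j -> u 0 l = 0].
Proof.
move=> ij a1 b1; exists (a *: e i + b *: e j); split.
- have [->|->] : a = 1 \/ a = -1 by lia.
    have [->|->] : b = 1 \/ b = -1 by lia.
      by rewrite !scale1r; apply: inverted_eD.
    by rewrite scale1r scaleN1r; apply: inverted_eB.
  have [->|->] : b = 1 \/ b = -1 by lia.
    by rewrite scale1r scaleN1r addrC; apply: inverted_eB; rewrite eq_sym.
  by rewrite !scaleN1r -opprD; apply/invertedN/inverted_eD.
- by rewrite !mxE !eqxx (negbTE ij) mulr1 mulr0 addr0.
- by rewrite !mxE !eqxx eq_sym (negbTE ij) mulr1 mulr0 add0r.
by move=> l li lj; rewrite !mxE (negbTE li) (negbTE lj) andbF !mulr0 addr0.
Qed.

Lemma implied_sign a v : `|a|%N = 1%N -> implied v -> implied (a *: v).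
Proof.
move=> a1 gv; have [->|->] : a = 1 \/ a = -1 by lia.
  by rewrite scale1r.
by rewrite scaleN1r; apply: impliedN.
Qed.

Lemma implied_axis i (a : int) : (`|a| <= 2)%N -> implied (a *: e i).
Proof.
move=> a2; have [->|a0] := eqVneq a 0; first by rewrite scale0r.
have [a1|a1] : `|a|%N = 1%N \/ `|a|%N = 2%N by lia.
  exact/implied_sign/inverted_implied/inverted_e.
have -> : a *: e i = (a %/ 2)%Z *: (e i *+ 2).
  by rewrite -scalerMnr scalerMnl; congr (_ *: _); lia.
by apply: implied_sign; [lia | apply/inverted_implied/inverted_2e].
Qed.

Lemma implied_small_pair i j (a b : int) : i != j -> (`|a| <= 1)%N ->
  (`|b| <= 1)%N -> implied (a *: e i + b *: e j).
Proof.
move=> ij a1 b1.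
have [->|a0] := eqVneq a 0.
  by rewrite scale0r add0r; apply: implied_axis; lia.
have [->|b0] := eqVneq b 0.
  by rewrite scale0r addr0; apply: implied_axis; lia.
have [||u [uu ui uj ul]] := @inverted_pair i j a b ij; try lia.
by rewrite -ui -uj -(two_coordinates ij ul); apply: inverted_implied.
Qed.

(** Halving with e_j, e_i + e_j, e_i + e_j.  The only one of the eight vectors
    outside H_n, up to sign, is 2 e_i + e_j; this is what the elements added to
    H_n in H_n' are for. *)
Lemma implied_2eBe i j : i != j -> implied (e i *+ 2 - e j).
Proof.
move=> ij.
have ue := inverted_e j; have ueD := inverted_eD ij.
apply: (implied_halving ue ueD ueD) => [l|w [s1 [s2 [s3 [hs1 hs2 hs3 hw]]]]].
  by rewrite !(mulr2n, mxE, eqxx) /=; lia.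
have w_eq : w = w 0 i *: e i + w 0 j *: e j.
  apply: two_coordinates ij _ => l /negbTE li /negbTE lj; have := hw l.
  rewrite !(mulr2n, mxE, eqxx) li lj /=; lia.
have := hw i; rewrite !(mulr2n, mxE, eqxx) (negbTE ij) /= => hwi.
have := hw j; rewrite !(mulr2n, mxE, eqxx) eq_sym (negbTE ij) /= => hwj.
rewrite w_eq.
have [wi2|wi2] := eqVneq (w 0 i) 2.
  have [wj0|wj1] : w 0 j = 0 \/ w 0 j = 1 by lia.
    by rewrite wi2 wj0 scale0r addr0; apply: implied_axis.
  by rewrite wi2 wj1 scale1r (scaler_nat 2 (e i)); apply: implied_2eDe.
have [wj2|wj2] := eqVneq (w 0 j) (-2).
  have -> : w 0 i = 0 by lia.
  by rewrite wj2 scale0r add0r; apply: implied_axis.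
by apply: implied_small_pair ij _ _; lia.
Qed.

(** The vectors at which the descent below sup-norm 2 stops. *)
Lemma implied_near_axis v i j : i != j ->
  (forall l, l != i -> l != j -> v 0 l = 0) ->
  (`|v 0%R i| <= 2)%N -> (`|v 0%R j| <= 1)%N -> implied v.
Proof.
move=> ij /(two_coordinates ij) ->.
have ji : (j == i) = false by rewrite eq_sym (negbTE ij).
move: (v 0 i) (v 0 j) => a b; rewrite !mxE !eqxx (negbTE ij) ji /=.
rewrite !(mulr0, mulr1, addr0, add0r) => a2 b1.
have [a1|a_gt1] := leqP `|a|%N 1; first exact: implied_small_pair.
have [->|b0] := eqVneq b 0; first by rewrite scale0r addr0; apply: implied_axis.
have [c [c1 ->]] : exists c, `|c|%N = 1%N /\ a = c * 2.
  by exists (a %/ 2)%Z; lia.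
have [->|->] : b = c \/ b = - c by lia.
  rewrite -scalerA -scalerDr scaler_nat.
  by apply: implied_sign c1 _; apply: implied_2eDe.
rewrite -scalerA scaleNr -scalerBr scaler_nat.
by apply: implied_sign c1 _; apply: implied_2eBe.
Qed.

(** An entrywise order rather than a norm: each halving below is then checked
    one coordinate at a time. *)
Definition shorter w v : Prop :=
  (forall l, (`|w 0%R l| <= `|v 0%R l|)%N) /\
  (exists l, (`|w 0%R l| < `|v 0%R l|)%N).

Lemma shorter_induction (P : 'rV[int]_n -> Prop) :
  (forall v, (forall w, shorter w v -> P w) -> P v) -> forall v, P v.
Proof.
move=> step v; have [m] := ubnP (\sum_l `|v 0%R l|)%N.
elim: m v => // m IHm v ltm; apply: step => w [wv [k wvk]]; apply: IHm.
move: ltm; rewrite ltnS; apply: leq_trans; rewrite (bigD1 k) // [leqRHS](bigD1 k) //=.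
by rewrite -addSn leq_add // leq_sum.
Qed.

(** If v has an odd entry, the vector x supported on the odd entries together
    with e_k, e_k fixes the parities; every entry 2 other than the one at k is
    halved to 1.  If v is even, the vector with entries v_k / 2 at k and
    - v_k' / 2 at k' is used with e_k, e_k': it enters with the sign against
    v at one of k, k', and there the entry 2 drops. *)
Lemma implied_two_twos v k k' : k' != k ->
  (forall l, (`|v 0%R l| <= 2)%N) ->
  `|v 0%R k|%N = 2%N -> `|v 0%R k'|%N = 2%N ->
  (forall w, shorter w v -> implied w) -> implied v.
Proof.
move=> k'k v2 vk vk' IH.
have kk' : (k == k') = false by rewrite eq_sym (negbTE k'k).
have [o /eqP vo|no1] := pickP (fun l => `|v 0%R l|%N == 1%N).
  have [||x ux xP] := @inverted_support (fun l => `|v 0%R l|%N == 1%N).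
  - by exists o; apply/eqP.
  - by exists k; rewrite vk.
  have ue := inverted_e k.
  apply: (implied_halving ux ue ue) => [l|w [s1 [s2 [s3 [hs1 hs2 hs3 hw]]]]].
    by have := xP l; have := v2 l; rewrite !eE; lia.
  apply: IH; split=> [l|].
    by have := xP l; have := hw l; rewrite !eE; case: eqVneq => [->|_]; lia.
  by exists k'; have := xP k'; have := hw k'; rewrite !eE (negbTE k'k); lia.
have [|||u [uu uk uk' ul]] :=
    @inverted_pair k k' (v 0%R k %/ 2)%Z (- (v 0%R k' %/ 2)%Z);
  try by rewrite ?kk' //; lia.
apply: (implied_halving uu (inverted_e k) (inverted_e k')) => [l|w].
  have := no1 l; have := v2 l; rewrite !eE.
  have [->|lk] := eqVneq l k; first by rewrite uk kk'; lia.
  have [->|lk'] := eqVneq l k'; first by rewrite uk'; lia.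
  by rewrite ul //; lia.
move=> [s1 [s2 [s3 [hs1 hs2 hs3 hw]]]].
have := hw k; rewrite uk !eE eqxx kk' => hwk.
have := hw k'; rewrite uk' !eE eqxx (negbTE k'k) => hwk'.
apply: IH; split=> [l|].
  have := hw l; rewrite !eE; have [->|lk] := eqVneq l k; first by lia.
  have [->|lk'] := eqVneq l k'; first by lia.
  by rewrite ul //; lia.
have [s1_pos|s1_neg] : s1 = 1 \/ s1 = -1 by lia.
  by exists k'; lia.
by exists k; lia.
Qed.

(** The vector u with entries v_k / 2 at k and - v_o at o is used with x,
    supported on the remaining odd entries, and e_k.  If u enters with sign + it
    cancels the entry at o, and with sign - it lowers the entry at k. *)
Lemma implied_two_and_ones v k o o' :
  (forall l, l != k -> (`|v 0%R l| <= 1)%N) ->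
  `|v 0%R k|%N = 2%N -> `|v 0%R o|%N = 1%N -> `|v 0%R o'|%N = 1%N -> o' != o ->
  (forall w, shorter w v -> implied w) -> implied v.
Proof.
move=> v1 vk vo vo' o'o IH.
have ok : o != k by apply/eqP => ok; move: vo; rewrite ok vk.
have ko : (k == o) = false by rewrite eq_sym (negbTE ok).
have o'k : o' != k by apply/eqP => o'k; move: vo'; rewrite o'k vk.
have [||x ux xP] := @inverted_support (fun l => [&& `|v 0%R l|%N == 1%N & l != o]).
- by exists o'; rewrite vo' o'o.
- by exists o; rewrite eqxx andbF.
have [|||u [uu uk uo ul]] :=
    @inverted_pair k o (v 0%R k %/ 2)%Z (- v 0%R o); try by rewrite ?ko //; lia.
apply: (implied_halving uu ux (inverted_e k)) => [l|w].
  have := xP l; rewrite !eE.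
  have [->|lk] := eqVneq l k; first by rewrite uk vk /=; lia.
  have [->|lo] := eqVneq l o; first by rewrite uo vo /=; lia.
  by have := v1 l lk; rewrite ul //=; lia.
move=> [s1 [s2 [s3 [hs1 hs2 hs3 hw]]]].
have := xP k; rewrite vk /= => xk.
have := xP o; rewrite eqxx andbF => xo.
have := hw k; rewrite uk !eE eqxx => hwk.
have := hw o; rewrite uo !eE (negbTE ok) => hwo.
apply: IH; split=> [l|].
  have := hw l; have := xP l; rewrite !eE.
  have [->|lk] := eqVneq l k; first by lia.
  have [->|lo] := eqVneq l o; first by lia.
  by have := v1 l lk; rewrite ul //=; lia.
have [s1_pos|s1_neg] : s1 = 1 \/ s1 = -1 by lia.
  by exists o; lia.
by exists k; lia.
Qed.

(** With i, j, k in the support, e_i is used with the vector u whose entries are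
    v_j at j and - v_k at k: for either sign of u, one of the entries at j and k
    cancels.  The third vector takes care of the remaining odd entries when there
    are any. *)
Lemma implied_ones v : (forall l, (`|v 0%R l| <= 1)%N) ->
  (forall w, shorter w v -> implied w) -> implied v.
Proof.
move=> v1 IH.
have [i vi|v0] := pickP (fun l => v 0 l != 0); last first.
  suff -> : v = 0 by [].
  by apply/rowP => l; rewrite mxE; have := v0 l; lia.
have [j /andP[vj ji]|v0] := pickP (fun l => (v 0 l != 0) && (l != i)); last first.
  have [j ji] := exists_other i.
  apply: (@implied_near_axis v i j); rewrite ?v1 ?(leq_trans (v1 _)) // 1?eq_sym //.
  by move=> l li lj; have := v0 l; rewrite li; lia.
have [k /and3P[vk ki kj]|v0] :=
    pickP (fun l => [&& v 0 l != 0, l != i & l != j]); last first.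
  apply: (@implied_near_axis v i j); rewrite ?v1 ?(leq_trans (v1 _)) // 1?eq_sym //.
  by move=> l li lj; have := v0 l; rewrite li lj; lia.
have v1i := v1 i; have v1j := v1 j; have v1k := v1 k.
have jk : j != k by rewrite eq_sym.
have [||u [uu uj uk ul]] := @inverted_pair j k (v 0%R j) (- v 0%R k) jk; try by lia.
have ui : u 0 i = 0 by apply: ul; rewrite eq_sym.
have [m /and4P[vm mi mj mk]|v0] :=
    pickP (fun l => [&& v 0 l != 0, l != i, l != j & l != k]).
  have [||x ux xP] :=
      @inverted_support (fun l => [&& v 0 l != 0, l != i, l != j & l != k]).
  - by exists m; rewrite vm mi mj mk.
  - by exists i; rewrite eqxx andbF.
  have xi : x 0 i = 0 by apply/eqP; rewrite -absz_eq0 xP eqxx andbF.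
  have xj : x 0 j = 0 by apply/eqP; rewrite -absz_eq0 xP eqxx !andbF.
  have xk : x 0 k = 0 by apply/eqP; rewrite -absz_eq0 xP eqxx !andbF.
  have xl l : l != i -> l != j -> l != k -> `|x 0%R l|%N = `|v 0%R l|%N.
    by move=> li lj lk; rewrite xP li lj lk andbT; have := v1 l; clear; lia.
  have uxl l : l != i -> l != j -> l != k ->
      u 0 l = 0 /\ `|x 0%R l|%N = `|v 0%R l|%N.
    by move=> li lj lk; split; [apply: ul | apply: xl].
  move: vi vj vk v1i v1j v1k => {vm mi mj mk m xP xl jk ul} vi vj vk v1i v1j v1k.
  apply: (implied_halving (inverted_e i) uu ux) => [l|w].
    rewrite !eE.
    have [->|li] := eqVneq l i; first by rewrite ui xi; lia.
    have [->|lj] := eqVneq l j; first by rewrite uj xj; lia.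
    have [->|lk] := eqVneq l k; first by rewrite uk xk; lia.
    by have [-> {li lj lk}] := uxl l li lj lk; lia.
  move=> [s1 [s2 [s3 [hs1 hs2 hs3 hw]]]].
  have := hw j; rewrite uj xj !eE (negbTE ji) => hwj.
  have := hw k; rewrite uk xk !eE (negbTE ki) => hwk.
  apply: IH; split=> [l|].
    have := hw l; rewrite !eE.
    have [->|li] := eqVneq l i; first by rewrite ui xi; lia.
    have [->|lj] := eqVneq l j; first by clear -hwj hs2 vj v1j; lia.
    have [->|lk] := eqVneq l k; first by clear -hwk hs2 vk v1k; lia.
    have [-> xl] := uxl l li lj lk; have := v1 l.
    by clear -xl hs1 hs2 hs3; lia.
  have [s2_pos|s2_neg] := hs2.
    by exists k; clear -hwk s2_pos vk; lia.
  by exists j; clear -hwj s2_neg vj; lia.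
(* The support is {i, j, k}; the even vector 2 e_i completes the triple, and the
   entry at i may grow to 2, but then at most one other entry is left. *)
apply: (implied_halving (inverted_e i) uu (inverted_2e i)) => [l|w].
  have := v1 l; have := v0 l; rewrite !(e2E, eE).
  have [->|li] := eqVneq l i; first by rewrite ui /=; lia.
  have [->|lj] := eqVneq l j; first by rewrite uj /=; lia.
  have [->|lk] := eqVneq l k; first by rewrite uk /=; lia.
  by rewrite ul //; lia.
move=> [s1 [s2 [s3 [hs1 hs2 hs3 hw]]]].
have := hw i; rewrite ui !(e2E, eE) eqxx /= => hwi.
have := hw j; rewrite uj !(e2E, eE) (negbTE ji) /= => hwj.
have := hw k; rewrite uk !(e2E, eE) (negbTE ki) /= => hwk.
have hwl l : l != i -> l != j -> l != k -> w 0 l = 0.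
  move=> li lj lk; have := hw l; have := v0 l.
  by rewrite (ul l) // !(e2E, eE) (negbTE li) lj lk /=; lia.
have [s2_pos|s2_neg] : s2 = 1 \/ s2 = -1 by lia.
  apply: (@implied_near_axis w i j); rewrite 1?eq_sym //; try by lia.
  by move=> l li lj; have [->|lk] := eqVneq l k; [lia | apply: hwl].
apply: (@implied_near_axis w i k); rewrite 1?eq_sym //; try by lia.
by move=> l li lk; have [->|lj] := eqVneq l j; [lia | apply: hwl].
Qed.

Lemma implied_norm_le2 v : (forall l, (`|v 0%R l| <= 2)%N) -> implied v.
Proof.
elim/shorter_induction: v => v IH v2.
have {}IH w : shorter w v -> implied w.
  by move=> wv; apply: IH => // l; apply: leq_trans (wv.1 l) (v2 l).
have [k /eqP vk|no2] := pickP (fun l => `|v 0%R l|%N == 2%N); last first.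
  by apply: implied_ones => // l; have := v2 l; have := no2 l; lia.
have [k' /andP[/eqP vk' k'k]|no2] :=
    pickP (fun l => (`|v 0%R l|%N == 2%N) && (l != k)).
  exact: implied_two_twos k'k v2 vk vk' IH.
have v1 l : l != k -> (`|v 0%R l| <= 1)%N.
  by move=> lk; have := v2 l; have := no2 l; rewrite lk; lia.
have [o /andP[vo ok]|no1] := pickP (fun l => (v 0 l != 0) && (l != k)); last first.
  have [j jk] := exists_other k.
  apply: (@implied_near_axis v k j); rewrite ?vk ?v1 // 1?eq_sym // => l lk _.
  by have := no1 l; rewrite lk; lia.
have [o' /and3P[vo' o'k o'o]|no1] :=
    pickP (fun l => [&& v 0 l != 0, l != k & l != o]).
  have := v1 _ ok; have := v1 _ o'k => vo'1 vo1.
  by apply: (@implied_two_and_ones v k o o') => //; lia.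
apply: (@implied_near_axis v k o); rewrite ?vk ?v1 // 1?eq_sym // => l lk lo.
by have := no1 l; rewrite lk lo; lia.
Qed.

(** One halving suffices to reach sup-norm below N.  For mixed parities it uses
    a vector of G_n and e_k twice, with v even at k; for v even,
    e_j + e_k, e_j, e_k.  In both cases the entries obtained are at most
    (N + 2) / 2 < N.  For v odd everywhere it uses e_j + e_i, e_i and a vector of
    G_n that vanishes only at j: the entry at i is at most (|v_i| + 3) / 2, which
    is why i has to be an index with |v_i| + 3 < 2 N. *)
Lemma implied_descent (N : nat) v : (3 <= N)%N ->
  (forall w, (forall l, (`|w 0%R l| < N)%N) -> implied w) ->
  (forall l, (`|v 0%R l| <= N)%N) ->
  (exists i, (`|v 0%R i| + 3 < N + N)%N \/ ~~ odd `|v 0%R i|%N) -> implied v.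
Proof.
move=> N3 IH vN [i0 vi0].
have [k evk|all_odd] := pickP (fun l => ~~ odd `|v 0%R l|%N).
  have [o ovo|all_even] := pickP (fun l => odd `|v 0%R l|%N).
    have [||x ux xP] := @inverted_support (fun l => odd `|v 0%R l|%N).
    - by exists o.
    - by exists k.
    apply: (implied_halving ux (inverted_e k) (inverted_e k)) => [l|w].
      by have := xP l; rewrite !eE; lia.
    move=> [s1 [s2 [s3 [hs1 hs2 hs3 hw]]]]; apply: IH => l.
    have := vN l; have := xP l; have := hw l; rewrite !eE.
    by clear -hs1 hs2 hs3 N3 evk; have [->|_] := eqVneq l k; lia.
  have [j jk] := exists_other k.
  have kj : (k == j) = false by rewrite eq_sym (negbTE jk).
  have ukj := inverted_eD jk.
  apply: (implied_halving ukj (inverted_e j) (inverted_e k)) => [l|w].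
    by have := all_even l; rewrite !(eDE, eE); lia.
  move=> [s1 [s2 [s3 [hs1 hs2 hs3 hw]]]]; apply: IH => l.
  have := vN l; have := hw l; rewrite !(eDE, eE).
  have [->|lk] := eqVneq l k; first by rewrite kj; lia.
  by lia.
have {}vi0 : (`|v 0%R i0| + 3 < N + N)%N.
  by case: vi0 => //; rewrite all_odd.
have [j ji] := exists_other i0.
have [||x ux xP] := @inverted_support (fun l => l != j).
- by exists i0; rewrite eq_sym.
- by exists j; rewrite eqxx.
apply: (implied_halving (inverted_eD ji) (inverted_e i0) ux) => [l|w].
  by have := all_odd l; have := xP l; rewrite !(eDE, eE); lia.
move=> [s1 [s2 [s3 [hs1 hs2 hs3 hw]]]]; apply: IH => l.
have := vN l; have := xP l; have := hw l; rewrite !(eDE, eE).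
have [->|li] := eqVneq l i0; first by lia.
by have [->|lj] := eqVneq l j; lia.
Qed.

(** If all entries are 3 or -3, the halving for odd vectors leaves an entry of
    size 3 only at i, which brings the vectors back to the case of an entry below
    3. *)
Lemma implied_norm_le3 v : (forall l, (`|v 0%R l| <= 3)%N) -> implied v.
Proof.
move=> v3.
have implied_lt3 w : (forall l, (`|w 0%R l| < 3)%N) -> implied w.
  exact: implied_norm_le2.
have descent w i : (forall l, (`|w 0%R l| <= 3)%N) -> (`|w 0%R i| < 3)%N ->
    implied w.
  by move=> w3 wi; apply: (@implied_descent 3) => //; exists i; lia.
have [i vi|all3] := pickP (fun l => (`|v 0%R l| < 3)%N); first exact: descent vi.
have {}all3 l : `|v 0%R l|%N = 3%N by have := v3 l; have := all3 l; lia.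
have [j _] := exists_other (Ordinal (ltnW n_ge2)).
have [i ij] := exists_other j.
have [||x ux xP] := @inverted_support (fun l => l != j).
- by exists i.
- by exists j; rewrite eqxx.
apply: (implied_halving (inverted_eD ij) (inverted_e i) ux) => [l|w].
  by have := all3 l; have := xP l; rewrite !(eDE, eE); lia.
move=> [s1 [s2 [s3 [hs1 hs2 hs3 hw]]]]; apply: (descent w j) => [l|].
  have := all3 l; have := xP l; have := hw l; rewrite !(eDE, eE).
  have [->|li] := eqVneq l i; first by lia.
  by have [->|lj] := eqVneq l j; lia.
have := all3 j; have := xP j; have := hw j.
by rewrite !(eDE, eE) eqxx eq_sym (negbTE ij); lia.
Qed.

Lemma implied_all v : implied v.
Proof.
have [N vN] : exists N, forall l, (`|v 0%R l| <= N)%N.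
  by exists (\max_l `|v 0%R l|)%N => l; apply: (leq_bigmax l).
elim: N v vN => [|N IH] v vN.
  by apply: implied_norm_le3 => l; apply: leq_trans (vN l) _.
have [N3|N3] := leqP N.+1 3.
  by apply: implied_norm_le3 => l; apply: leq_trans (vN l) N3.
apply: (@implied_descent N.+1); rewrite ?(ltnW N3) //.
have [j _] := exists_other (Ordinal (ltnW n_ge2)).
by exists j; left; have := vN j; lia.
Qed.

End Descent.

(** * The sets H_n *)

Section Hn.
Variables (n : nat) (x : {ffun 'I_n -> bool} -> 'rV[int]_n).
Hypothesis x_norm : forall l, L l -> supnorm (x l) = 1%N.
Hypothesis x_supp : forall l, L l -> forall i : 'I_n, (x l 0 i != 0) = l i.

Lemma x_absE l i : L l -> `|x l 0%R i|%N = l i.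
Proof.
move=> Ll; have := x_supp Ll i.
have : (`|x l 0%R i| <= supnorm (x l))%N by apply: (leq_bigmax i).
by rewrite x_norm //; case: (l i); lia.
Qed.

Lemma Hset_support (P : pred 'I_n) : (exists i, P i) -> (exists i, ~~ P i) ->
  exists2 u, Hset x u & forall i, `|u 0%R i|%N = P i.
Proof.
move=> [i Pi] [j Pj]; pose l := [ffun i => P i].
have Ll : L l.
  split=> /ffunP.
    by move=> /(_ i); rewrite !ffunE Pi.
  by move=> /(_ j); rewrite !ffunE (negbTE Pj).
exists (x l); first by left; left; left; exists l.
by move=> k; rewrite x_absE // ffunE.
Qed.

Lemma Hset_neq0 : ~ Hset x 0.
Proof.
have coord (v : 'rV[int]_n) : 0 = v -> forall i, v 0 i = 0.
  by move=> <- i; rewrite mxE.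
move=> [[[[l Ll /esym xl0]|[i /coord/(_ i)]]|]|[i /coord/(_ i)]].
- apply: Ll.1; apply/ffunP => i; rewrite ffunE.
  by have := x_absE i Ll; rewrite (coord _ xl0); case: (l i).
- by rewrite eE eqxx.
- move=> [i [j [/negbTE ij [/coord/(_ i)|/coord/(_ i)]]]].
    by rewrite eDE eqxx ij.
  by rewrite !mxE !eqxx ij.
- by rewrite e2E eqxx.
Qed.

End Hn.

Theorem theorem2p8 (n : nat) (hn : (2 <= n)%N)
    (x : {ffun 'I_n -> bool} -> 'rV[int]_n)
    (x_norm : forall l, L l -> supnorm (x l) = 1%N)
    (x_supp : forall l, L l -> forall i : 'I_n, (x l 0 i != 0) = l i) :
  integrally_implied (Hset x) (Hset' x) [set: 'rV[int]_n].
Proof.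
move=> v _; split; first exact: Hset_neq0.
have [phi to_WE] := to_W_rmorphism 'rV[int]_n.
have net_phi := universal_net to_WE.
have W_red := @W_reduced 'rV[int]_n.
have SJ : Hset x `<=` Hset' x by move=> u; left.
pose t u := phi (T u); pose C := clearable (Hset x) (Hset' x) phi.
have CD w z : C w -> C z -> C (w + z) by apply: clearableD.
have CN w : C w -> C (- w) by apply: clearableN.
have CM w z : C w -> C z -> C (w * z) by apply: clearableM.
have CT u : Hset' x u -> C (t u) by apply: clearable_T.
have CS u : Hset x u -> C (t u) by move/SJ/CT.
have C_div u w : Hset x u -> C (w * t u) -> C w by apply: clearable_div.
suff [d [m Sm ->] [Q JQ vmE]] : C (t v).
  exists false, m, Q; split; [exact: Sm | exact: JQ |].
  by rewrite !to_WE -vmE; apply: rmorph_mul_sign0.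
apply: (@implied_all n (up_to_sign (Hset x)) (fun u => C (t u))).
- exact: hn.
- exact: up_to_signN.
- by move=> i; left; left; left; right; exists i.
- by move=> i; left; right; exists i.
- by move=> i j ij; left; left; right; exists i, j; split; [|left].
- by move=> i j ij; left; left; right; exists i, j; split; [|right].
- move=> P Pex PNex.
  by have [u Su uP] := Hset_support x_norm x_supp Pex PNex; exists u; [left|].
- exact: (up_to_sign_implied W_red net_phi CN CS).
- by rewrite [t 0]net_phi.1; apply: clearable0.
- exact: (implied_opp W_red net_phi CN).
- by move=> i j ij; apply: CT; right; exists i, j.
exact: (implied_halving W_red net_phi CD CN CM C_div).
Qed.
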